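(* Let $(\hat{\mathcal{A}},[\cdot,\cdot]_\wedge,\hat N)$ be an abelian extension of a Nijenhuis mock-Lie algebra $(\mathcal{A},[\cdot,\cdot],N)$ by $(V,\mu,N_V)$ (where $\mu=0$), and let $s:\mathcal{A}\to\hat{\mathcal{A}}$ be a section. Define $\bar\rho_V:\mathcal{A}\to\mathrm{End}(V)$ by $\bar\rho_V(x)(u)=[s(x),u]_\wedge$ for $x\in\mathcal{A}$, $u\in V$ (with $V$ identified with $i(V)\subseteq\hat{\mathcal{A}}$). Then $(V,\bar\rho_V,N_V)$ is a representation of the Nijenhuis mock-Lie algebra $(\mathcal{A},[\cdot,\cdot],N)$. Moreover, this representation is independent of the choice of the section $s$.
   Context: All vector spaces are over a field $K$ of characteristic zero. A mock-Lie algebra $(\mathcal{A},[\cdot,\cdot])$ is a vector space with a commutative bilinear map $[\cdot,\cdot]$ such that $[x,[y,z]]+[y,[z,x]]+[z,[x,y]]=0$. A Nijenhuis mock-Lie algebra $(\mathcal{A},[\cdot,\cdot],N)$ is a mock-Lie algebra with a linear map $N$ such that $[N(x),N(y)]+N^2([x,y])=N([N(x),y])+N([x,N(y)])$. Morphisms are linear maps commuting with brackets and with the operators. A representation of $(\mathcal{A},[\cdot,\cdot],N)$ is a triple $(V,\rho,\alpha)$ with $V$ a vector space, $\rho:\mathcal{A}\to\mathrm{End}(V)$ linear satisfying $\rho([x,y])v=-\rho(x)(\rho(y)v)-\rho(y)(\rho(x)v)$, and $\alpha:V\to V$ linear satisfying $\rho(N(x))\alpha(v)+\alpha^2(\rho(x)v)=\alpha(\rho(N(x))v)+\alpha(\rho(x)\alpha(v))$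 for all $x,y\in\mathcal{A}$, $v\in V$. Let $V$ be a vector space with a linear operator $N_V$ and zero bracket $\mu=0$; then $(V,\mu,N_V)$ is a Nijenhuis mock-Lie algebra. An abelian extension of $(\mathcal{A},[\cdot,\cdot],N)$ by $(V,\mu,N_V)$ is a Nijenhuis mock-Lie algebra $(\hat{\mathcal{A}},[\cdot,\cdot]_\wedge,\hat N)$ together with a short exact sequence of morphisms of Nijenhuis mock-Lie algebras $0\to V\xrightarrow{i}\hat{\mathcal{A}}\xrightarrow{p}\mathcal{A}\to0$. A section is a linear map $s:\mathcal{A}\to\hat{\mathcal{A}}$ with $p\circ s=\mathrm{id}_{\mathcal{A}}$. *)

(* Defs.v *)
From HB Require Import structures.
From mathcomp Require Import all_boot all_algebra.

Set Implicit Arguments.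
Unset Strict Implicit.
Unset Printing Implicit Defensive.

Import GRing.Theory.
Local Open Scope ring_scope.

Record nijMockLie (K : fieldType) := NijMockLie {
  nml_sort :> lmodType K;
  bracket : {bilinear nml_sort -> nml_sort -> nml_sort};
  nijop : {linear nml_sort -> nml_sort};
  bracketC : forall x y, bracket x y = bracket y x;
  bracket_jacobi : forall x y z,
    bracket x (bracket y z) + bracket y (bracket z x)
      + bracket z (bracket x y) = 0;
  bracket_nijenhuis : forall x y,
    bracket (nijop x) (nijop y) + nijop (nijop (bracket x y))
      = nijop (bracket (nijop x) y) + nijop (bracket x (nijop y))
}.

Record nml_morphism (K : fieldType) (A B : nijMockLie K) := NmlMorphism {
  nml_fun :> {linear A -> B};
  nml_bracket : forall x y,
    nml_fun (bracket A x y) = bracket B (nml_fun x) (nml_fun y);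
  nml_nijop : forall x, nml_fun (nijop A x) = nijop B (nml_fun x)
}.

(* rho is kept uncurried from End(V); its first two clauses say that it is a
   linear map from A to the space of linear endomorphisms of V. *)
Definition is_representation (K : fieldType) (A : nijMockLie K)
    (V : lmodType K) (rho : A -> V -> V) (alpha : {linear V -> V}) : Prop :=
  [/\ forall x, linear (rho x),
      forall v, linear (rho^~ v),
      forall x y v,
        rho (bracket A x y) v = - rho x (rho y v) - rho y (rho x v)
    & forall x v,
        rho (nijop A x) (alpha v) + alpha (alpha (rho x v))
          = alpha (rho (nijop A x) v) + alpha (rho x (alpha v))].

Section ZeroBracket.
Variables (K : fieldType) (V : lmodType K) (NV : {linear V -> V}).

Definition zero_bracket (_ _ : V) : V := 0.

Lemma zero_bracket_bilinear : bilinear_for *:%R *:%R zero_bracket.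
Proof. by split=> u a x y; rewrite /zero_bracket /= scaler0 addr0. Qed.

HB.instance Definition _ := bilinear_isBilinear.Build K V V V *:%R *:%R
  zero_bracket zero_bracket_bilinear.

Lemma zero_bracket_jacobi (x y z : V) :
  zero_bracket x (zero_bracket y z) + zero_bracket y (zero_bracket z x)
    + zero_bracket z (zero_bracket x y) = 0.
Proof. by rewrite /zero_bracket !addr0. Qed.

Lemma zero_bracket_nijenhuis (x y : V) :
  zero_bracket (NV x) (NV y) + NV (NV (zero_bracket x y))
    = NV (zero_bracket (NV x) y) + NV (zero_bracket x (NV y)).
Proof. by rewrite /zero_bracket !linear0. Qed.

Definition abelian_nml : nijMockLie K :=
  @NijMockLie K V zero_bracket NV (fun _ _ => erefl)
    zero_bracket_jacobi zero_bracket_nijenhuis.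

End ZeroBracket.

Record abelian_extension (K : fieldType) (A : nijMockLie K)
    (V : lmodType K) (NV : {linear V -> V}) := AbelianExtension {
  ext_alg :> nijMockLie K;
  ext_i : nml_morphism (abelian_nml NV) ext_alg;
  ext_p : nml_morphism ext_alg A;
  ext_inj : injective ext_i;
  ext_exact : forall e, ext_p e = 0 <-> exists u, ext_i u = e;
  ext_surj : forall x, exists e, ext_p e = x
}.

Definition is_section (K : fieldType) (A : nijMockLie K) (V : lmodType K)
    (NV : {linear V -> V}) (E : abelian_extension A NV)
    (s : {linear A -> E}) : Prop :=
  forall x, ext_p E (s x) = x.

Section InducedAction.
Variables (K : fieldType) (A : nijMockLie K) (V : lmodType K).
Variables (NV : {linear V -> V}) (E : abelian_extension A NV).

Lemma bracket_in_image (e : E) (u : V) :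
  exists v : V, ext_i E v == bracket E e (ext_i E u).
Proof.
have /ext_exact[v Hv] : ext_p E (bracket E e (ext_i E u)) = 0.
  have p_i : ext_p E (ext_i E u) = 0 by apply/ext_exact; exists u.
  by rewrite nml_bracket p_i linear0r.
by exists v; apply/eqP.
Qed.

(* Without identifying V with i(V), rho_bar s x u is the unique preimage of
   [s x, i u] under the injection i (see rho_barP). *)
Definition rho_bar (s : {linear A -> E}) (x : A) (u : V) : V :=
  xchoose (bracket_in_image (s x) u).

Lemma rho_barP (s : {linear A -> E}) (x : A) (u : V) :
  ext_i E (rho_bar s x u) = bracket E (s x) (ext_i E u).
Proof. exact/eqP/(xchooseP (bracket_in_image (s x) u)). Qed.

End InducedAction.

(* Main.v *)
Require Import Defs.
From mathcomp Require Import all_boot all_algebra.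

Import GRing.Theory.
Local Open Scope ring_scope.

(** The bracket of [V] is zero, so [i V] brackets trivially with itself in the
    extension; hence [e, i u] depends only on the class of [e] modulo [i V],
    that is, on [p e] ([bracket_ext_i_eq]).  Independence of the section is the
    case [e = s x], [e' = s' x].  The same principle lets [s [x, y]] be replaced
    by [[s x, s y]], and [s (N x)] by [N (s x)], whenever they act on [i V]: a
    section need not be a morphism, but it is one modulo [i V].  After these
    replacements, the two representation identities become, under the
    injection [i], the Jacobi and Nijenhuis identities of the extension,
    evaluated at elements [s x], [s y] and [i u]. *)

Section InducedActionTheory.
Set Implicit Arguments.
Unset Strict Implicit.

Variables (K : fieldType) (A : nijMockLie K) (V : lmodType K).
Variables (NV : {linear V -> V}) (E : abelian_extension A NV).
Implicit Types (e : E) (u v : V).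

Lemma bracket_ext_i2 u v : bracket E (ext_i E u) (ext_i E v) = 0.
Proof.
by rewrite -nml_bracket (linear0 (ext_i E)).
Qed.

Lemma ext_i_nijop u : nijop E (ext_i E u) = ext_i E (NV u).
Proof. by rewrite -nml_nijop. Qed.

(** Two lifts of the same element of [A] differ, by exactness, by an element
    of [i V], and such an element annihilates [i V]. *)
Lemma bracket_ext_i_eq e e' u : ext_p E e = ext_p E e' ->
  bracket E e (ext_i E u) = bracket E e' (ext_i E u).
Proof.
move=> eq_p.
have /ext_exact[w i_w] : ext_p E (e - e') = 0 by rewrite linearB eq_p subrr.
by apply/eqP; rewrite -subr_eq0 -linearBl -i_w bracket_ext_i2.
Qed.

Variable s : {linear A -> E}.

Lemma rho_bar_linearr x : linear (rho_bar s x).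
Proof.
move=> a u v; apply: (@ext_inj _ _ _ _ E).
by rewrite rho_barP !(linearP (ext_i E)) linearPr !rho_barP.
Qed.

Lemma rho_bar_linearl u : linear ((rho_bar s)^~ u).
Proof.
move=> a x y; apply: (@ext_inj _ _ _ _ E).
by rewrite rho_barP (linearP (ext_i E)) linearP linearPl !rho_barP.
Qed.

Hypothesis s_section : is_section s.

(** This frees the action from [s]: the representation identities use it with
    the lifts [[s x, s y]] and [N (s x)], and independence of the section with
    the value of another section. *)
Lemma rho_bar_lift e x u : ext_p E e = x ->
  ext_i E (rho_bar s x u) = bracket E e (ext_i E u).
Proof.
by move=> p_e; rewrite rho_barP; apply: bracket_ext_i_eq; rewrite s_section.
Qed.

Lemma rho_bar_bracket x y v :
  rho_bar s (bracket A x y) v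
    = - rho_bar s x (rho_bar s y v) - rho_bar s y (rho_bar s x v).
Proof.
apply: (@ext_inj _ _ _ _ E).
have p_sxy : ext_p E (bracket E (s x) (s y)) = bracket A x y.
  by rewrite nml_bracket !s_section.
rewrite (rho_bar_lift _ p_sxy) (linearB (ext_i E)) (linearN (ext_i E)) !rho_barP.
have := bracket_jacobi (s x) (s y) (ext_i E v).
rewrite (bracketC (ext_i E v) (s x)) (bracketC (ext_i E v)) => /eqP.
by rewrite addrC addr_eq0 opprD => /eqP.
Qed.

Lemma rho_bar_nijop x v :
  rho_bar s (nijop A x) (NV v) + NV (NV (rho_bar s x v))
    = NV (rho_bar s (nijop A x) v) + NV (rho_bar s x (NV v)).
Proof.
apply: (@ext_inj _ _ _ _ E).
have p_Nsx : ext_p E (nijop E (s x)) = nijop A x.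
  by rewrite nml_nijop s_section.
rewrite !(linearD (ext_i E)) -!ext_i_nijop !(rho_bar_lift _ p_Nsx) !rho_barP.
by rewrite -!ext_i_nijop bracket_nijenhuis.
Qed.

End InducedActionTheory.

Theorem theorem3p8 (K : fieldType) (charK0 : [pchar K] =i pred0)
    (A : nijMockLie K) (V : lmodType K) (NV : {linear V -> V})
    (E : abelian_extension A NV)
    (s : {linear A -> E}) (s_section : is_section s) :
  is_representation (rho_bar s) NV /\
  (forall s' : {linear A -> E}, is_section s' ->
     forall (x : A) (u : V), rho_bar s' x u = rho_bar s x u).
Proof.
split=> [|s' s'_section x u].
  split; [exact: rho_bar_linearr | exact: rho_bar_linearl | |].
    exact: rho_bar_bracket.
  exact: rho_bar_nijop.
apply: (@ext_inj _ _ _ _ E).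
by rewrite rho_barP (rho_bar_lift s_section _ (s'_section x)).
Qed.
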